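(* Let $\varphi\in C[0,1]$ be strictly positive. For $n\geq 2$ and $g\in C[0,1]$ let $$B_{n-1}g(x)=\sum_{k=0}^{n-1}g\left(\frac{k}{n-1}\right)\binom{n-1}{k}x^k(1-x)^{n-1-k}.$$ (1) If $\varphi\in C^1[0,1]$, then $Q_{n-1}:=B_{n-1}\varphi$ satisfies property (W) for all sufficiently large $n\in\mathbb{N}$. (2) If $\varphi$ is Lipschitz continuous, then there exist $n_0\in\mathbb{N}$ and $a_0>0$ such that for all $n\geq n_0$ and all $a\geq a_0$ the polynomial $B_{n-1}(a+\varphi)$ satisfies property (W).
   Context: $C[0,1]$ is the space of continuous real-valued functions on $[0,1]$ and $C^1[0,1]$ the space of continuously differentiable ones. Property (W) for a polynomial $Q_{n-1}(x)=\sum_{k=0}^{n-1}w_{n-1,k}\binom{n-1}{k}x^k(1-x)^{n-1-k}$ with strictly positive Bernstein coefficients $w_{n-1,k}$ means: $$\frac{w_{n-1,k-1}w_{n-1,k+1}}{w_{n-1,k}^2}<\frac{k+1}{k}\cdot\frac{n-k}{n-k-1}\qquad\text{for } k=1,\dots,n-2.$$ *)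

(* Defs.v *)
From mathcomp Require Import all_boot all_order all_algebra.
From mathcomp Require Import all_classical all_reals all_analysis.

Set Implicit Arguments.
Unset Strict Implicit.
Unset Printing Implicit Defensive.

Import Order.TTheory GRing.Theory Num.Theory.
Import numFieldNormedType.Exports.

Local Open Scope classical_set_scope.
Local Open Scope ring_scope.

(* A function on [0,1] is represented by a total function R -> R, of which only
   the restriction to [0,1] is ever used. *)

(* The difference quotient is taken inside [0,1], so the derivative is one-sided
   at the endpoints and the values of f outside [0,1] are irrelevant. *)
Definition has_derivative_on01 (R : realType) (f f' : R -> R) : Prop :=
  forall x : R, x \in `[0, 1] ->
    (f y - f x) / (y - x) @[y --> within `[0, 1] x^'] --> f' x.

Definition C1_on01 (R : realType) (f : R -> R) : Prop :=
  exists2 f' : R -> R,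
    has_derivative_on01 f f' & {within `[0, 1], continuous f'}.

Definition bernstein_basis (R : realType) (m k : nat) : {poly R} :=
  'C(m, k)%:R *: ('X^k * (1 - 'X) ^+ (m - k)).

Definition bernstein (R : realType) (m : nat) (g : R -> R) : {poly R} :=
  \sum_(k < m.+1) g (k%:R / m%:R) *: bernstein_basis R m k.

(* Here Q is the polynomial Q_{n-1}, expanded in the Bernstein basis of degree
   n - 1; its coefficients w are unique, so the quantifier over w only names
   them. *)
Definition property_W (R : realType) (n : nat) (Q : {poly R}) : Prop :=
  exists w : nat -> R,
    [/\ forall k, (k < n)%N -> 0 < w k,
        Q = \sum_(k < n) w k *: bernstein_basis R n.-1 k
      & forall k, (1 <= k <= n - 2)%N ->
          w k.-1 * w k.+1 / w k ^+ 2 <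
          (k.+1%:R / k%:R) * ((n - k)%:R / (n - k - 1)%:R)].

(* Main.v *)
Require Import Defs.
From mathcomp Require Import all_boot all_order all_algebra.
From mathcomp Require Import all_classical all_reals all_analysis.
From mathcomp Require Import ring lra.

(** Write [m = n - 1] and [w_k = g (k / m)], the Bernstein coefficients of
    [bernstein m g].  The bound in property (W) factors as
    [(1 + 1/k) (1 + 1/(m - k))], and both [k] and [m - k] are smaller than [m],
    so it exceeds [(1 + 1/m)^2] ([sqr_1DV_lt]).  By the arithmetic-geometric
    mean inequality [w_(k-1) w_(k+1)] is at most the square of half the sum
    [w_(k-1) + w_(k+1)].  Hence (W) holds as soon as this half sum is at most
    [w_k (1 + 1/m)], that is, as soon as the second difference
    [w_(k-1) + w_(k+1) - 2 w_k] is at most [2 c / m], where [c > 0] is a lower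
    bound of [g] ([property_W_bernstein]).

    It remains to bound second differences of step [h = 1/m].  If [phi] is
    continuously differentiable they are [o(h)] uniformly: the mean value
    theorem turns them into [h] times the difference of two values of the
    derivative at points less than [2 h] apart, and the derivative is uniformly
    continuous ([C1_on01_second_difference]); [c] is then the minimum of
    [phi].  If [phi] is [L]-Lipschitz they are at most [2 L h], and adding a
    constant [a >= L] to [phi] does not change them while it makes [c = L] a
    lower bound of the function. *)

Set Implicit Arguments.
Unset Strict Implicit.
Unset Printing Implicit Defensive.

Import Order.TTheory GRing.Theory Num.Theory.
Import numFieldNormedType.Exports.

Local Open Scope classical_set_scope.
Local Open Scope ring_scope.

(** The arithmetic-geometric mean inequality, for a half sum exceeding [w] by a
    relative amount of at most [t]. *)
Lemma mulr_le_sqr_of_addr_le (R : realFieldType) (u v w t : R) :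
  0 <= u -> 0 <= v -> u + v <= 2 * (w * (1 + t)) ->
  u * v <= w ^+ 2 * (1 + t) ^+ 2.
Proof.
move=> u0 v0 uv; rewrite -exprMn; set s := w * (1 + t) in uv *.
have : (u + v) ^+ 2 <= (2 * s) ^+ 2 by rewrite lerXn2r ?nnegrE; lra.
have : 0 <= (u - v) ^+ 2 by exact: sqr_ge0.
by rewrite !expr2; nra.
Qed.

Lemma sqr_1DV_lt (R : realFieldType) (a b : R) :
  0 < a -> 0 < b ->
  (1 + (a + b)^-1) ^+ 2 < ((a + 1) / a) * ((b + 1) / b).
Proof.
move=> a0 b0.
have -> : (a + 1) / a = 1 + a^-1 by field; rewrite gt_eqF.
have -> : (b + 1) / b = 1 + b^-1 by field; rewrite gt_eqF.
have ab0 : 0 < a + b by exact: addr_gt0.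
have sa : (a + b)^-1 < a^-1 by rewrite ltf_pV2 ?posrE ?ltrDl.
have sb : (a + b)^-1 < b^-1 by rewrite ltf_pV2 ?posrE ?ltrDr.
have s0 : 0 < (a + b)^-1 by rewrite invr_gt0.
by rewrite expr2 ltr_pM //; lra.
Qed.

Lemma grid_in01 (R : realType) (m k : nat) :
  (k <= m)%N -> (k%:R / m%:R : R) \in `[0, 1].
Proof.
case: m => [|m] km; first by rewrite invr0 mulr0 in_itv /= lexx ler01.
by rewrite in_itv /= divr_ge0 //= ler_pdivrMr ?ltr0n // mul1r ler_nat.
Qed.

(** The reduction of (W) to a one-sided bound on second differences: such a
    bound gives [(w_(k-1) + w_(k+1)) / 2 <= w_k + c / m <= w_k (1 + 1/m)], and
    the arithmetic-geometric mean inequality concludes. *)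
Lemma property_W_bernstein (R : realType) (m : nat) (g : R -> R) (c : R) :
  (0 < m)%N -> 0 < c -> (forall x, x \in `[0, 1] -> c <= g x) ->
  (forall x, 0 <= x - m%:R^-1 -> x + m%:R^-1 <= 1 ->
     g (x - m%:R^-1) + g (x + m%:R^-1) - 2 * g x <= 2 * c * m%:R^-1) ->
  property_W m.+1 (bernstein m g).
Proof.
move=> m0 c0 gc g2; have M0 : 0 < m%:R :> R by rewrite ltr0n.
have g0 k : (k <= m)%N -> 0 < g (k%:R / m%:R).
  by move=> km; apply: lt_le_trans (gc _ _) => //; exact: grid_in01.
exists (fun k => g (k%:R / m%:R)); split=> // k; rewrite subSS => /andP[k1 kn].
have {kn} km : (k < m)%N by rewrite -(subnK m0) addn1 ltnS.
have mE : m%:R = k%:R + (m - k)%:R :> R by rewrite -natrD subnKC // ltnW.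
have K0 : 0 < k%:R :> R by rewrite ltr0n.
have J0 : 0 < (m - k)%:R :> R by rewrite ltr0n subn_gt0.
have wk := g0 _ (ltnW km).
rewrite (subSn (ltnW km)) subn1 /= -(natr1 k) -(natr1 (m - k)).
apply: le_lt_trans (sqr_1DV_lt K0 J0).
rewrite -mE ler_pdivrMr ?exprn_gt0 // [leRHS]mulrC.
have prevE : k.-1%:R / m%:R = k%:R / m%:R - m%:R^-1 :> R.
  by rewrite -{2}(prednK k1) -natr1 mulrDl mul1r addrK.
have nextE : (k%:R + 1) / m%:R = k%:R / m%:R + m%:R^-1 :> R.
  by rewrite mulrDl mul1r.
have : c * m%:R^-1 <= g (k%:R / m%:R) * m%:R^-1.
  by rewrite ler_wpM2r ?invr_ge0 ?ler0n //; exact/gc/grid_in01/ltnW.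
have := g2 (k%:R / m%:R); rewrite -prevE -nextE divr_ge0 //.
rewrite ler_pdivrMr // mul1r natr1 ler_nat => /(_ isT km) gk cw.
apply: mulr_le_sqr_of_addr_le; last by rewrite mulrDr mulr1; lra.
- by apply/ltW/g0; exact: leq_trans (leq_pred k) (ltnW km).
- exact/ltW/g0.
Qed.

(** Heine's theorem on a segment.  Compactness is used through near coverings:
    a property of [d] and [x] that holds for all small [d] near each point of
    the segment holds on the whole segment for some common [d]. *)
Lemma within_continuous_uniform (R : realType) (f : R -> R) (a b e : R) :
  {within `[a, b], continuous f} -> 0 < e ->
  exists2 d : R, 0 < d & forall x y, x \in `[a, b] -> y \in `[a, b] ->
    `|x - y| < d -> `|f x - f y| < e.
Proof.
move=> fc e0.
have e20 : 0 < e / 2 by rewrite divr_gt0.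
have /compact_near_coveringP := @segment_compact R a b.
move=> /(_ R (0 : R)^'+ (fun d x => x \in `[a, b] -> forall y, y \in `[a, b] ->
    `|x - y| < d -> `|f x - f y| < e)) => /(_ _ _)[].
  move=> x abx.
  have /subspace_continuousP/(_ x abx)/cvgrPdist_lt/(_ _ e20) := fc.
  rewrite near_withinE => /nbhs_ballP[r /= r0 xr].
  exists (ball x (r / 2), [set d | 0 < d < r / 2]) => /=.
    split; first by apply: nbhsx_ballx; rewrite divr_gt0.
    near=> d; apply/andP; split; near: d.
      exact: nbhs_right_gt.
    by apply: nbhs_right_lt; rewrite divr_gt0.
  (* [z] and [y] both lie within [r / 2 + r / 2] of [x], where [f] is within
     [e / 2] of [f x]. *)
  move=> [z d] /= [xz /andP[d0 dr]] abz y aby zy.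
  move: xz; rewrite /ball /= => xz.
  have /xr/(_ abz) fz : ball x r z by rewrite /ball /=; lra.
  have /xr/(_ aby) fy : ball x r y.
    rewrite /ball /= -(subrKA z).
    by apply: le_lt_trans (ler_normD _ _) _; lra.
  rewrite -(subrKA (f x)); apply: le_lt_trans (ler_normD _ _) _.
  by move: fz fy; rewrite /from_subspace (distrC (f z)); lra.
move=> r /= r0 fr; have r20 : 0 < r / 2 by rewrite divr_gt0.
exists (r / 2) => // x y abx aby xy.
apply: (fr (r / 2)) => //.
by rewrite /= sub0r normrN gtr0_norm //; lra.
Unshelve. all: by end_near. Qed.

(** At an interior point a whole neighbourhood lies in [[0, 1]], so the limit
    taken inside the interval is an ordinary derivative. *)
Lemma has_derivative_on01_is_derive (R : realType) (f f' : R -> R) (x : R) :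
  has_derivative_on01 f f' -> x \in `]0, 1[ -> is_derive x 1 f (f' x).
Proof.
move=> fd x01.
have : (h^-1 *: ((f \o shift x) (h *: 1) - f x)) @[h --> 0^'] --> f' x.
  have /fd/cvgrPdist_lt xd : x \in `[0, 1] by exact: subset_itv_oo_cc.
  apply/cvgrPdist_lt => e /xd; rewrite !near_withinE.
  have : \forall y \near x, y \in `]0, 1[ by exact: near_in_itvoo.
  move=> /nbhs0P oo /nbhs0P xe; near=> h => h0.
  have xh01 : x + h \in `[0, 1].
    by apply: subset_itv_oo_cc; near: h.
  have : x + h != x by rewrite -subr_eq0 addrAC subrr add0r.
  move=> xhx; rewrite /= [h *: 1]mulr1 (addrC h x) [_ *: _]mulrC.
  have hE : x + h - x = h by rewrite addrAC subrr add0r.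
  rewrite -[X in _ / X]hE.
  by move: xhx xh01; near: h.
move=> fx; split; first by apply/cvg_ex; exists (f' x).
exact: cvg_lim.
Unshelve. all: by end_near. Qed.

(** Second differences of a [C^1] function are [o(h)] uniformly in [x]: each of
    the two increments is [h] times a value of the derivative, and these values
    are close by uniform continuity. *)
Lemma C1_on01_second_difference (R : realType) (f : R -> R) (e : R) :
  {within `[0, 1], continuous f} -> C1_on01 f -> 0 < e ->
  exists2 d : R, 0 < d & forall x h, 0 < h < d -> 0 <= x - h -> x + h <= 1 ->
    f (x - h) + f (x + h) - 2 * f x <= e * h.
Proof.
move=> fc [f' fd f'c] e0.
have [d d0 f'd] := within_continuous_uniform f'c e0.
(* The two mean value points lie in an interval of length [2 * h]. *)
exists (d / 2); first by rewrite divr_gt0.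
move=> x h /andP[h0 hd] xh0 xh1.
have mvt a b : 0 <= a -> a < b -> b <= 1 ->
    exists2 c, c \in `]a, b[ & f b - f a = f' c * (b - a).
  move=> a0 ab b1; apply: MVT => // [y|].
    rewrite in_itv /= => /andP[ay yb].
    by apply: has_derivative_on01_is_derive => //; rewrite in_itv /=; lra.
  apply: continuous_subspaceW fc => y /=; rewrite !in_itv /=.
  by move=> /andP[ay yb]; lra.
have [|||p] := mvt (x - h) x; [lra..|].
rewrite in_itv /= => /andP[p1 p2] fp.
have [|||q] := mvt x (x + h); [lra..|].
rewrite in_itv /= => /andP[q1 q2] fq.
have : `|f' q - f' p| < e.
  by apply: f'd; rewrite ?in_itv /= ?ltr_norml; lra.
move=> /ltW/(le_trans (ler_norm _)) /(ler_wpM2r (ltW h0)).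
by nra.
Qed.

Theorem theorem18 (R : realType) (phi : R -> R)
    (phi_cont : {within `[0, 1], continuous phi})
    (phi_gt0 : forall x : R, x \in `[0, 1] -> 0 < phi x) :
  (C1_on01 phi ->
     exists n0 : nat, (2 <= n0)%N /\
       forall n : nat, (n0 <= n)%N -> property_W n (bernstein n.-1 phi)) /\
  ([lipschitz phi x | x in `[0, 1]] ->
     exists (n0 : nat) (a0 : R), [/\ (2 <= n0)%N, 0 < a0 &
       forall (n : nat) (a : R), (n0 <= n)%N -> a0 <= a ->
         property_W n (bernstein n.-1 (fun x => a + phi x))]).
Proof.
split=> [phiC1|/pinfty_ex_gt0[L L0 phiL]].
- have [x0 x001 phi_min] := EVT_min ler01 phi_cont.
  have c0 : 0 < phi x0 by exact: phi_gt0.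
  have [|d d0 phi2] := C1_on01_second_difference phi_cont phiC1 (e := 2 * phi x0).
    by rewrite mulr_gt0.
  (* With [n = m.+2] the step is [1 / m.+1], which must be less than [d]. *)
  exists (Num.bound d^-1).+2; split=> // -[|[|m]] // nm.
  apply: (property_W_bernstein (c := phi x0)) => // x xh0 xh1.
  apply: phi2 => //; rewrite invr_gt0 ltr0n /= invf_plt ?posrE ?ltr0n //.
  apply: lt_le_trans (archi_boundP _) _; first by rewrite invr_ge0 ltW.
  by rewrite ler_nat; exact: leqW.
- exists 2, L; split=> // n a; case: n => [|[|m]] // _ La.
  apply: (property_W_bernstein (c := L)) => // x.
    by move=> /phi_gt0; lra.
  set h := _^-1 => xh0 xh1.
  have h0 : 0 < h by rewrite invr_gt0 ltr0n.
  have lip t : `|t| = h -> x + t \in `[0, 1] -> phi (x + t) - phi x <= L * h.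
    move=> th xt01; apply: le_trans (ler_norm _) _.
    rewrite -th -[X in L * `|X|](addrK x) (addrC t); apply: (phiL (x + t, x)).
    by split => //=; rewrite in_itv /=; lra.
  have := lip (- h); rewrite normrN gtr0_norm // => /(_ erefl) lipl.
  have := lip h; rewrite gtr0_norm // => /(_ erefl) lipr.
  have := lipl ltac:(rewrite in_itv /=; lra).
  have := lipr ltac:(rewrite in_itv /=; lra).
  by lra.
Qed.
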